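(* Let $p\geq 5$ be a prime, $k\geq 1$ an integer, $q=p^k$, and $G_q=\mathrm{PSL}(2,q)$. Let $H\leq G_q$ be a cyclic subgroup of order $p$, and consider the transitive action of $G_q$ by right multiplication on the set of right cosets of $H$. Then the intersection density of this action is \[ \rho(G_q)=\begin{cases} \dfrac{q}{p} & \text{if } k \text{ is odd},\\[2mm] \dfrac{\sqrt{q}}{p} & \text{if } k \text{ is even},\end{cases} \] where, when $k$ is even, this holds for either of the two conjugacy classes of subgroups of order $p$ in $G_q$ (i.e. whichever cyclic subgroup of order $p$ is chosen as $H$).
   Context: For a finite transitive permutation group $G\leq \mathrm{Sym}(\Omega)$, a subset $\mathcal{F}\subseteq G$ is intersecting if for all $g,h\in\mathcal{F}$ there is $\omega\in\Omega$ with $\omega^g=\omega^h$. The intersection density of $G$ is $\rho(G)=\max\{|\mathcal{F}| : \mathcal{F}\subseteq G \text{ intersecting}\}/(|G|/|\Omega|)$, i.e. the maximum size of an intersecting set divided by the order of a point stabilizer. *)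

(* Defs.v *)
From mathcomp Require Import all_boot all_order all_fingroup all_algebra all_solvable.

Set Implicit Arguments.
Unset Strict Implicit.
Unset Printing Implicit Defensive.

Import GroupScope GRing.Theory.

Section IntersectionDensity.

Variables (aT : finGroupType) (rT : finType) (to : {action aT &-> rT}).

Definition intersecting (S : {set rT}) (X : {set aT}) : bool :=
  [forall g in X, forall h in X, exists w in S, to w g == to w h].

(* This is meant for a transitive action of G on S. A permutation group
   G <= Sym(T) is the case to := 'P, S := [set: T]. *)
Definition intersection_density (G : {set aT}) (S : {set rT}) : rat :=
  ((\max_(X : {set aT} | (X \subset G) && intersecting S X) #|X|)%N%:R
     / (#|G|%:R / #|S|%:R))%R.

End IntersectionDensity.

Section PSL2.

Variable F : finFieldType.

Definition SL2 : {set {'GL_2[F]}} := [set x | (\det (GLval x) == 1)%R].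

Lemma SL2_group_set : group_set SL2.
Proof.
apply/group_setP; split=> [|x y]; first by rewrite inE GL_1E det1.
by rewrite !inE GL_MxE det_mulmx => /eqP-> /eqP->; rewrite mulr1.
Qed.

Canonical SL2_group := group SL2_group_set.

Definition PSL2 : {set coset_of 'Z(SL2)} := SL2 / 'Z(SL2).

Canonical PSL2_group := Eval hnf in [group of PSL2].

End PSL2.

(* Main.v *)
(* Two elements g, h agree on a coset of H iff g h^-1 is conjugate into H, and H
   is generated by the image of a transvection u(a) = [[1, a], [0, 1]].  After
   translating, an intersecting set contains 1, so its elements lift to matrices
   1 + N with N nilpotent, and each pair satisfies tr (N M) = 0 or 4, the two
   values coming from the sign ambiguity in PSL(2, q).  Here tr (N M) = 0 means
   that N and M are parallel.  If the value 4 occurs, any two distinct nonzero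
   N's are at 4; but four vectors pairwise at 4 would be independent
   in the 3-dimensional space of traceless matrices, so the set has at most
   4 < p elements.  Otherwise the set lies in a single unipotent subgroup, i.e. it
   is a set T of field elements whose differences have the form r^2 a i with
   i in F_p.  If k is odd, F_p contains a nonsquare and T can be the whole
   field.  If k is even, F_p consists of squares, T / a is a clique of the Paley
   graph, hence |T|^2 <= q, with equality for the subfield of order sqrt q. *)

Require Import Defs.
From mathcomp Require Import all_boot all_order all_fingroup all_algebra all_solvable.
From mathcomp Require Import finfield ring zify.

Set Implicit Arguments.
Unset Strict Implicit.
Unset Printing Implicit Defensive.

Import Order.TTheory GroupScope GRing.Theory Num.Theory.
Local Open Scope ring_scope.

(** * Intersecting sets for the action on right cosets *)

Section IntersectingCosets.

Variables (gT : finGroupType) (G H : {group gT}).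
Hypothesis sHG : H \subset G.

Lemma intersecting_rcosetsP (X : {set gT}) : X \subset G ->
  reflect {in X &, forall g h, (g * h^-1)%g \in class_support H G}
          (intersecting 'Rs%act (rcosets H G) X).
Proof.
move=> sXG; apply: (iffP forall_inP) => [iX g h Xg Xh | cX g Xg].
  have /exists_inP[w] := forall_inP (iX g Xg) h Xh.
  case/rcosetsP=> y Gy -> /eqP /=; rewrite !rcosetE -!rcosetM => /rcoset_eqP.
  rewrite mem_rcoset invMg => Hy.
  rewrite -[(g * _)%g](conjgKV y) memJ_class_support //.
  by rewrite conjgE invgK; rewrite !mulgA in Hy *.
apply/forall_inP=> h Xh; have /imset2P[x y Hx Gy Dgh] := cX g h Xg Xh.
apply/exists_inP; exists (H :* y)%g; first by apply/rcosetsP; exists y.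
apply/eqP; rewrite /= !rcosetE -!rcosetM; apply/rcoset_eqP; rewrite mem_rcoset invMg.
by rewrite mulgA -[(_ * g * _)%g]mulgA Dgh conjgE !mulgA mulgV mul1g mulgK.
Qed.

(** Since |G| / |G : H| = |H|, only the largest size [m] of an intersecting set has to be found; it
    enters as a bound that is attained. *)
Lemma intersection_density_rcosets (m : nat) :
  (exists2 X : {set gT}, X \subset G /\ #|X| = m
     & {in X &, forall g h, (g * h^-1)%g \in class_support H G}) ->
  (forall X : {set gT}, X \subset G ->
     {in X &, forall g h, (g * h^-1)%g \in class_support H G} -> (#|X| <= m)%N) ->
  intersection_density 'Rs%act G (rcosets H G) = m%:R / #|H|%:R.
Proof.
move=> [X [sXG cardX] cX] max_m; rewrite /intersection_density.
have -> : (\max_(X : {set gT} | (X \subset G) &&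
             intersecting 'Rs%act (rcosets H G) X) #|X|)%N = m.
  apply/eqP; rewrite eqn_leq; apply/andP; split.
    apply/bigmax_leqP=> Y /andP[sYG /intersecting_rcosetsP cY].
    exact: max_m sYG (cY sYG).
  rewrite -cardX; apply: leq_bigmax_cond; rewrite sXG /=.
  exact/intersecting_rcosetsP.
congr (_ / _); rewrite -(Lagrange sHG) natrM mulfK // pnatr_eq0.
by rewrite -lt0n indexg_gt0.
Qed.

End IntersectingCosets.

(** * Squares in finite fields, by way of discrete logarithms *)

Lemma finField_generator (F : finFieldType) :
  {g : F | g != 0 /\ (forall x, x != 0 -> exists j, x = g ^+ j)
     & forall i j, (g ^+ i == g ^+ j) = (i == j %[mod #|F|.-1])}.
Proof.
have /cyclicP/sig_eqW[u Du] := field_unit_group_cyclic [set: {unit F}].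
have ou : #[u] = #|F|.-1.
  by rewrite /order -Du card_finField_unit.
exists (val u); [split | ].
- by rewrite -unitfE (valP u).
- move=> x; rewrite -unitfE => Ux.
  have: FinRing.unit F Ux \in <[u]> by rewrite -Du inE.
  by case/cycleP=> j /(congr1 val); rewrite /= FinRing.val_unitX; exists j.
by move=> i j; rewrite -!FinRing.val_unitX (inj_eq val_inj) eq_expg_mod_order ou.
Qed.

Section FieldSquares.

Variable F : finFieldType.

Definition is_square (x : F) : bool := [exists s, x == s ^+ 2].

Lemma is_squareP x : reflect (exists s, x = s ^+ 2) (is_square x).
Proof. exact: 'exists_eqP. Qed.

Lemma is_square0 : is_square 0.
Proof. by apply/is_squareP; exists 0; rewrite expr0n. Qed.

Lemma is_squareM x y : is_square x -> is_square y -> is_square (x * y).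
Proof.
move=> /is_squareP[s ->] /is_squareP[t ->].
by apply/is_squareP; exists (s * t); rewrite exprMn.
Qed.

Lemma is_squareV x : is_square x -> is_square x^-1.
Proof. by case/is_squareP=> s ->; apply/is_squareP; exists s^-1; rewrite exprVn. Qed.

Lemma nonsquare_neq0 x : ~~ is_square x -> x != 0.
Proof. by apply: contraNneq => ->; exact: is_square0. Qed.

Lemma is_square_expr g j : ~~ odd j -> is_square (g ^+ j).
Proof.
move=> even_j; apply/is_squareP; exists (g ^+ j./2).
by rewrite -exprM muln2 even_halfK.
Qed.

(** Nonsquares are odd powers of the generator, and two odd exponents have an even sum. *)
Lemma nonsquareM x y : ~~ is_square x -> ~~ is_square y -> is_square (x * y).
Proof.
have [g [_ g_gen] _] := finField_generator F.
move=> sqx sqy.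
have [i Dx] := g_gen x (nonsquare_neq0 sqx).
have [j Dy] := g_gen y (nonsquare_neq0 sqy).
have odd_i: odd i by apply: contraNT sqx => /is_square_expr sq; rewrite Dx.
have odd_j: odd j by apply: contraNT sqy => /is_square_expr sq; rewrite Dy.
by rewrite Dx Dy -exprD is_square_expr // oddD odd_i odd_j.
Qed.

(** The easy half of Euler's criterion: for x = s ^ 2 the power is s ^ (q - 1), with q the order of
    F. *)
Lemma expf_half_card x : odd #|F| -> x != 0 -> is_square x -> x ^+ #|F|.-1./2 = 1.
Proof.
move=> oddF nzx /is_squareP[s Dx].
have /predU1P[s0|nzs] : (s == 0) || (s != 0) by case: eqP.
  by rewrite Dx s0 expr0n eqxx in nzx.
rewrite Dx -exprM mul2n even_halfK //.
  apply: (mulfI nzs); rewrite -exprS prednK ?expf_card ?mulr1 //.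
  exact: ltnW (finNzRing_gt1 F).
by case: #|F| oddF.
Qed.

Lemma exists_nonsquare : odd #|F| -> exists n : F, ~~ is_square n.
Proof.
move=> oddF; have [g [nzg _] g_inj] := finField_generator F; exists g.
have F_gt2: (2 < #|F|)%N.
  by have:= finNzRing_gt1 F; case: #|F| oddF => [|[|[]]].
apply/negP=> /(expf_half_card oddF nzg)/eqP.
rewrite -(expr0 g) g_inj mod0n modn_small; lia.
Qed.

(* The map (x, y) |-> x + n * y is injective on X * X when n is not a square. *)
Lemma square_difference_clique (X : {set F}) : odd #|F| ->
  {in X &, forall x y, is_square (x - y)} -> (#|X| ^ 2 <= #|F|)%N.
Proof.
move=> oddF sqX; have [n sq'n] := exists_nonsquare oddF.
rewrite -mulnn -cardsX -(card_in_imset (f := fun xy : F * F => xy.1 + n * xy.2)).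
  exact: max_card.
move=> [x y] [x' y'] /setXP[/= Xx Xy] /setXP[/= Xx' Xy'] Exy.
have [Ey | nzy] := eqVneq y y'; first by move: Exy; rewrite Ey => /addIr->.
have Dn: n = (x - x') / (y' - y).
  apply: canRL (mulfK _) _; first by rewrite subr_eq0 eq_sym.
  by rewrite mulrBr (canRL (addrK _) Exy); ring.
by case/negP: sq'n; rewrite Dn is_squareM ?is_squareV ?sqX.
Qed.

Variables (p k : nat).
Hypotheses (p_prime : prime p) (F_card : #|F| = (p ^ k)%N).

Lemma finField_pchar : (0 < k)%N -> p \in [pchar F].
Proof. by move=> k_gt0; apply: (card_finPcharP F_card p_prime). Qed.

Lemma odd_card : odd p -> odd #|F|.
Proof. by rewrite F_card oddX => ->; rewrite orbT. Qed.

(** All terms are odd. For n = k the sum is (p ^ k - 1) / (p - 1), the index of the units of F_p in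
    those of F, and its parity decides whether F_p contains nonsquares of F. *)
Lemma odd_sum_expn n : odd p -> odd (\sum_(i < n) p ^ i) = odd n.
Proof.
move=> odd_p; elim: n => [|n IHn]; first by rewrite big_ord0.
by rewrite big_ord_recr oddD /= IHn oddX odd_p orbT addbT.
Qed.

(** A generator n of the units of F_p fails Euler's criterion: (q - 1) / 2 is an odd multiple of (p
    - 1) / 2, hence not a multiple of p - 1. *)
Lemma nat_nonsquare : odd p -> odd k -> exists i : nat, ~~ is_square (i%:R : F).
Proof.
move=> odd_p odd_k; have k_gt0 := odd_gt0 odd_k.
have charF := finField_pchar k_gt0.
have [n [nz_n _] n_inj] := finField_generator 'F_p.
have n_gt0 : (0 < val n)%N.
  by rewrite lt0n; apply: contraNneq nz_n => n0; rewrite -(natr_Zp n) n0.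
exists (val n); apply/negP=> /(expf_half_card (odd_card odd_p)).
(* This moves the equation n ^ ((q - 1) / 2) = 1 from F to F_p, where the order of n is known. *)
have nat_eq0 i : ((i%:R : F) == 0) = ((i%:R : 'F_p) == 0).
  by rewrite -(dvdn_pcharf charF) -(dvdn_pcharf (pchar_Fp p_prime)).
rewrite nat_eq0 natr_Zp => /(_ nz_n)/eqP.
rewrite -natrX -subr_eq0 -[1]/(1%:R) -natrB ?expn_gt0 ?n_gt0 //.
rewrite nat_eq0 natrB ?expn_gt0 ?n_gt0 //.
rewrite natrX natr_Zp subr_eq0 -(expr0 n) n_inj card_Fp // F_card predn_exp.
have p_gt1 := prime_gt1 p_prime.
have ->: ((p.-1 * \sum_(i < k) p ^ i)./2 = p.-1./2 * \sum_(i < k) p ^ i)%N.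
  by rewrite -{1}[p.-1]even_halfK -?doubleMl ?doubleK //; lia.
have [K ->] : exists K, (\sum_(i < k) p ^ i = 1 + K.*2)%N.
  by exists (\sum_(i < k) p ^ i)./2; rewrite -{1}[LHS]odd_double_half odd_sum_expn ?odd_k.
have Dp : p.-1 = p.-1./2.*2 by lia.
have ->: (p.-1./2 * (1 + K.*2) = K * p.-1 + p.-1./2)%N by rewrite {3}Dp; lia.
by rewrite modnMDl mod0n modn_small; lia.
Qed.

(** For i nonzero in F, i ^ (p - 1) = 1 makes the discrete logarithm of i a multiple of (q - 1) / (p
    - 1), which is even for even k. *)
Lemma is_square_nat i : odd p -> (0 < k)%N -> ~~ odd k -> is_square (i%:R : F).
Proof.
move=> odd_p k_gt0 even_k; apply: contraT => sq'i.
have nzi := nonsquare_neq0 sq'i.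
have charF := finField_pchar k_gt0.
have [g [_ g_gen] g_inj] := finField_generator F.
have [j Di] := g_gen _ nzi.
have p_gt1 := prime_gt1 p_prime.
have: (i%:R : F) ^+ p.-1 == g ^+ 0.
  apply/eqP; rewrite expr0; apply: (mulfI nzi); rewrite -exprS prednK ?prime_gt0 //.
  by rewrite mulr1 -(pFrobenius_autE charF) pFrobenius_aut_nat.
rewrite Di -exprM g_inj F_card predn_exp mod0n => /dvdnP[c].
rewrite mulnCA mulnC => /eqP; rewrite eqn_pmul2l; last by lia.
move=> /eqP Dj; case/negP: sq'i; rewrite Di is_square_expr // Dj oddM.
by rewrite odd_sum_expn // (negPf even_k) andbF.
Qed.

(* The nonzero elements of the subfield of order m are the powers of g ^+ m.+1, and
   m.+1 is even. *)
Lemma square_subfield m : odd p -> (0 < k)%N -> (m = p ^ k./2)%N -> ~~ odd k ->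
   exists E : {set F}, [/\ #|E| = m, {in E &, forall x y, x - y \in E}
                         & {in E, forall x, is_square x}].
Proof.
move=> odd_p k_gt0 Dm even_k; have charF := finField_pchar k_gt0.
have Dq : #|F| = (m * m)%N by rewrite F_card Dm -expnD addnn even_halfK.
have odd_m : odd m by rewrite Dm oddX odd_p orbT.
have m_gt1 : (1 < m)%N.
  by have:= finNzRing_gt1 F; rewrite Dq; lia.
have Dq1 : #|F|.-1 = (m.-1 * m.+1)%N by rewrite Dq; lia.
have [g [nzg g_gen] g_inj] := finField_generator F.
pose f (o : option 'I_m.-1) : F := if o is Some i then g ^+ (m.+1 * i) else 0.
have f_inj : injective f.
  move=> [i|] [j|] //= /eqP; rewrite ?[0 == _]eq_sym ?(negPf (expf_neq0 _ nzg)) //.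
  rewrite g_inj Dq1 [(m.-1 * _)%N]mulnC -!muln_modr eqn_pmul2l // !modn_small //.
  by move/eqP/val_inj->.
(* The image of [f] is the fixed set of x |-> x ^ m. This map is an iterate of Frobenius, hence
   additive, which gives closure under subtraction. *)
have exprB : {morph (fun x : F => x ^+ m) : x y / x - y}.
  move=> x y; rewrite Dm; elim: (k./2) => [|n IHn]; first by rewrite !expr1.
  by rewrite expnSr !exprM IHn -!(pFrobenius_autE charF) pFrobenius_autB_comm //; apply: mulrC.
have fE x : x \in codom f -> x ^+ m = x.
  case/codomP=> [[i|]] -> /=; last by rewrite expr0n; case: (m) m_gt1.
  apply/eqP; rewrite -exprM g_inj Dq1 eqn_mod_dvd; last by nia.
  by apply/dvdnP; exists i; nia.
have Ef x : x ^+ m = x -> x \in codom f.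
  move=> xE; have [->|nzx] := eqVneq x 0; first exact: (codom_f f None).
  have [j Dx] := g_gen x nzx.
  have: g ^+ (j * m.-1) == g ^+ 0.
    rewrite exprM -Dx expr0; apply/eqP/(mulfI nzx).
    by rewrite -exprS prednK ?mulr1 // ltnW.
  rewrite g_inj mod0n Dq1 mulnC => /dvdnP[c] /eqP.
  rewrite mulnCA eqn_pmul2l => [/eqP Dj|]; last by lia.
  have c_lt : (c %% m.-1 < m.-1)%N by rewrite ltn_mod; lia.
  have ->: x = f (Some (Ordinal c_lt)).
    apply/eqP; rewrite Dx /f g_inj Dj Dq1 /= [(c * _)%N]mulnC [(m.-1 * _)%N]mulnC.
    by rewrite -!muln_modr eqn_pmul2l // modn_mod.
  exact: codom_f.
exists [set x in codom f]; split.
- by rewrite cardsE (card_codom f_inj) card_option card_ord prednK // ltnW.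
- by move=> x y; rewrite !inE => /fE xE /fE yE; apply: Ef; rewrite exprB xE yE.
move=> _ /[!inE] /codomP[[i|] ->]; rewrite /= ?is_square0 //.
by rewrite is_square_expr // oddM /= odd_m.
Qed.

End FieldSquares.

(** * SL(2, F) in matrix entries, and its center *)

Section SL2Coordinates.

Variable F : finFieldType.

Definition mx2 (a b c d : F) : 'M[F]_2 :=
  \matrix_(i, j) nth 0 (nth [::] [:: [:: a; b]; [:: c; d]] i) j.

Lemma mx2_eta (A : 'M[F]_2) : A = mx2 (A 0 0) (A 0 1) (A 1 0) (A 1 1).
Proof.
by apply/matrixP=> [[[|[|//]] Hi]] [[|[|//]] Hj]; rewrite mxE /=;
   congr (A _ _); apply: val_inj.
Qed.

Lemma mulmx2 a b c d a' b' c' d' : mx2 a b c d *m mx2 a' b' c' d' =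
  mx2 (a * a' + b * c') (a * b' + b * d') (c * a' + d * c') (c * b' + d * d').
Proof.
by apply/matrixP=> [[[|[|//]] Hi]] [[|[|//]] Hj];
   rewrite !mxE /= !big_ord_recl big_ord0 !mxE /= addr0.
Qed.

Lemma det_mx2 a b c d : \det (mx2 a b c d) = a * d - b * c.
Proof.
rewrite (expand_det_row _ 0) !big_ord_recl big_ord0 /cofactor !det_mx11 !mxE /=.
by rewrite !mul1r addr0 expr1 mulN1r mulrN.
Qed.

Lemma tr_mx2 a b c d : \tr (mx2 a b c d) = a + d.
Proof. by rewrite /mxtrace !big_ord_recl big_ord0 !mxE /= addr0. Qed.

Lemma mx2_scalar a : a%:M = mx2 a 0 0 a.
Proof.
by apply/matrixP=> [[[|[|//]] Hi]] [[|[|//]] Hj]; rewrite !mxE.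
Qed.

Lemma mx2_inj a b c d a' b' c' d' :
  mx2 a b c d = mx2 a' b' c' d' -> [/\ a = a', b = b', c = c' & d = d'].
Proof.
move/matrixP=> E; move: (E 0 0) (E 0 1) (E 1 0) (E 1 1).
by rewrite !mxE.
Qed.

(* Junk value 1 when the determinant a * d - b * c vanishes. *)
Definition sl2 (a b c d : F) : {'GL_2[F]} := insubd (1%g : {'GL_2[F]}) (mx2 a b c d).

Lemma sl2_val a b c d : a * d - b * c = 1 -> GLval (sl2 a b c d) = mx2 a b c d.
Proof.
move=> det1; apply: (insubdK (1%g : {'GL_2[F]})).
by rewrite -topredE /= unitmxE det_mx2 det1 unitr1.
Qed.

Lemma mem_sl2 a b c d : a * d - b * c = 1 -> sl2 a b c d \in SL2 F.
Proof. by move=> det1; rewrite inE sl2_val // det_mx2 det1. Qed.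

Lemma SL2P x : x \in SL2 F ->
  exists a b c d, a * d - b * c = 1 /\ x = sl2 a b c d.
Proof.
rewrite inE (mx2_eta (GLval x)) det_mx2 => /eqP det1.
do 4!eexists; split; first exact: det1.
by apply: val_inj; rewrite -[RHS]/(GLval _) sl2_val //; exact: mx2_eta.
Qed.

Lemma sl2_inj a b c d a' b' c' d' : a * d - b * c = 1 -> a' * d' - b' * c' = 1 ->
  sl2 a b c d = sl2 a' b' c' d' -> [/\ a = a', b = b', c = c' & d = d'].
Proof. by move=> ? ? /(congr1 (@GLval _ _)); rewrite !sl2_val // => /mx2_inj. Qed.

Lemma sl2M a b c d a' b' c' d' : a * d - b * c = 1 -> a' * d' - b' * c' = 1 ->
  (sl2 a b c d * sl2 a' b' c' d')%g =
  sl2 (a * a' + b * c') (a * b' + b * d') (c * a' + d * c') (c * b' + d * d').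
Proof.
move=> det1 det1'; apply: val_inj.
rewrite -[LHS]/(GLval _) -[RHS]/(GLval _) GL_MxE !sl2_val // ?mulmx2 //.
by transitivity ((a * d - b * c) * (a' * d' - b' * c')); [ring | rewrite det1 det1' mulr1].
Qed.

Lemma sl2_1 : sl2 1 0 0 1 = 1%g.
Proof.
by apply: val_inj; rewrite -[LHS]/(GLval _) sl2_val -?mx2_scalar //; ring.
Qed.

Lemma sl2V a b c d : a * d - b * c = 1 -> (sl2 a b c d)^-1%g = sl2 d (- b) (- c) a.
Proof.
move=> det1; apply/eqP; rewrite eq_invg_mul sl2M //; last by rewrite -det1; ring.
apply/eqP; rewrite -sl2_1 -det1; congr sl2; ring.
Qed.

Lemma tr_sl2 a b c d : a * d - b * c = 1 -> \tr (GLval (sl2 a b c d)) = a + d.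
Proof. by move=> det1; rewrite sl2_val ?tr_mx2. Qed.

Lemma trJ (x y : {'GL_2[F]}) : \tr (GLval (x ^ y)%g) = \tr (GLval x).
Proof.
rewrite conjgE !GL_MxE mxtrace_mulC -mulmxA -GL_MxE.
by rewrite mulgV GL_1E mulmx1.
Qed.

(** Commuting with [[1, 1], [0, 1]] forces c = 0 and a = d, and commuting with its transpose forces
    b = 0; the determinant then gives a ^ 2 = 1. *)
Lemma centerSL2P x : x \in 'Z(SL2 F)%g ->
  exists2 e, e = 1 \/ e = -1 & x = sl2 e 0 0 e.
Proof.
case/centerP=> /SL2P[a [b [c [d [det1 ->]]]]] comx.
have u_det : 1 * 1 - 1 * 0 = 1 :> F by ring.
have l_det : 1 * 1 - 0 * 1 = 1 :> F by ring.
have := comx _ (mem_sl2 u_det); rewrite /commute !sl2M // => /sl2_inj[].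
- by rewrite -[RHS]det1; ring.
- by rewrite -[RHS]det1; ring.
rewrite !(mulr1, mulr0, mul1r, mul0r, addr0, add0r) => /eqP.
rewrite -[X in X == _]addr0 (inj_eq (addrI _)) eq_sym => /eqP c0.
rewrite addrC => /addrI Dd _ _.
have := comx _ (mem_sl2 l_det); rewrite /commute !sl2M // => /sl2_inj[].
- by rewrite -[RHS]det1; ring.
- by rewrite -[RHS]det1; ring.
rewrite !(mulr1, mulr0, mul1r, mul0r, addr0, add0r) => /eqP.
rewrite -[X in _ == X]addr0 (inj_eq (addrI _)) => /eqP b0 _ _ _.
move: det1; rewrite b0 c0 -Dd mulr0 subr0 => /eqP.
rewrite -expr2 sqrf_eq1 => e1; exists a => //.
by case/orP: e1 => /eqP; [left | right].
Qed.

End SL2Coordinates.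

(** * Nilpotent traceless matrices as isotropic vectors *)

Section IsotropicVectors.

Variable F : finFieldType.

(* (a, b, c) encodes the traceless matrix [[a, b], [c, -a]]. *)
Notation vec := (F * F * F)%type.

(** For the encoded matrices this is tr (N M), the polar form of a ^ 2 + b c. *)
Definition polar (N M : vec) : F :=
  2%:R * N.1.1 * M.1.1 + N.1.2 * M.2 + N.2 * M.1.2.

(** The square of [[a, b], [c, -a]] is the scalar a ^ 2 + b c. *)
Definition nilpotent2 (N : vec) : bool := N.1.1 ^+ 2 + N.1.2 * N.2 == 0.

Definition scale2 (t : F) (N : vec) : vec := (t * N.1.1, t * N.1.2, t * N.2).

Lemma polar0r N : polar N 0 = 0.
Proof. by rewrite /polar /=; ring. Qed.

Lemma polarC N M : polar N M = polar M N.
Proof. by rewrite /polar; ring. Qed.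

Lemma polar_nilpotent N : nilpotent2 N -> polar N N = 0.
Proof.
move/eqP=> nN; transitivity (2%:R * (N.1.1 ^+ 2 + N.1.2 * N.2)); last by rewrite nN mulr0.
by rewrite /polar; ring.
Qed.

Lemma polar_scaler t N M : polar N (scale2 t M) = t * polar N M.
Proof. by rewrite /polar /=; ring. Qed.

Lemma nilpotent2_scale t N : nilpotent2 N -> nilpotent2 (scale2 t N).
Proof.
move=> /eqP nN; apply/eqP => /=; transitivity (t ^+ 2 * (N.1.1 ^+ 2 + N.1.2 * N.2)).
  by ring.
by rewrite nN mulr0.
Qed.

(** If b is nonzero, (a b' - a' b) ^ 2 is a combination of the three vanishing forms, so M is
    proportional to N in the first two coordinates, and orthogonality settles the third. If b = 0,
    both vectors lie on the c-axis. *)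
Lemma nilpotent2_parallel N M : nilpotent2 N -> nilpotent2 M -> N != 0 ->
  polar N M = 0 -> exists t, M = scale2 t N.
Proof.
case: N M => [[a b] c] [[a' b'] c']; rewrite /nilpotent2 /polar /scale2 /=.
move=> /eqP nN /eqP nM nzN orth.
have [b0 | nzb] := eqVneq b 0.
  move: nN nzN orth; rewrite b0 mul0r addr0 => /eqP; rewrite sqrf_eq0 => /eqP->.
  rewrite !xpair_eqE !eqxx /= => nzc; rewrite mulr0 !mul0r !add0r => /eqP.
  rewrite mulf_eq0 (negPf nzc) /= => /eqP b'0.
  move: nM; rewrite b'0 mul0r addr0 => /eqP; rewrite sqrf_eq0 => /eqP->.
  by exists (c' / c); rewrite !mulr0 divfK.
have Dc : c = - a ^+ 2 / b.
  by apply: (mulfI nzb); move/eqP: nN; rewrite addrC addr_eq0 => /eqP->; field.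
have: (a * b' - a' * b) ^+ 2 = 0.
  transitivity (b ^+ 2 * (a' ^+ 2 + b' * c') + b' ^+ 2 * (a ^+ 2 + b * c)
      - b * b' * (2%:R * a * a' + b * c' + c * b')); first by ring.
  by rewrite nM nN orth; ring.
move/eqP; rewrite sqrf_eq0 subr_eq0 => /eqP Eab; exists (b' / b).
have Da' : a' = b' / b * a by apply: (mulIf nzb); rewrite -Eab; field.
congr (_, _, _) => //; first by rewrite divfK.
apply: (mulfI nzb); apply/eqP; rewrite -subr_eq0 -orth Da' Dc; apply/eqP.
by field.
Qed.

Hypotheses (nz2 : 2%:R != 0 :> F) (nz3 : 3%:R != 0 :> F).

Lemma nz4 : 4%:R != 0 :> F.
Proof. by rewrite -[4%N]/(2 * 2)%N natrM mulf_neq0. Qed.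

(* The Gram matrix of four such vectors is 4(J - 1), with J the all-one matrix,
   and (J - 1)(J - 3) = 3; but the ambient space has dimension 3. *)
Lemma no_four_nilpotents (v : 'I_4 -> vec) : (forall i, nilpotent2 (v i)) ->
  ~ (forall i j, i != j -> polar (v i) (v j) = 4%:R).
Proof.
move=> nv v4.
pose A : 'M[F]_(4, 3) := \matrix_(i, j) [:: (v i).1.1; (v i).1.2; (v i).2]`_j.
pose B : 'M[F]_(3, 4) := \matrix_(j, i) [:: 2%:R * (v i).1.1; (v i).2; (v i).1.2]`_j.
pose J : 'M[F]_4 := const_mx 1.
have gram : A *m B = 4%:R *: (J - 1).
  apply/matrixP=> i j; rewrite !mxE !big_ord_recl big_ord0 !mxE /= addr0.
  transitivity (polar (v i) (v j)); first by rewrite /polar; ring.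
  have [->|ne] := eqVneq i j; first by rewrite polar_nilpotent // subrr mulr0.
  by rewrite v4 // subr0 mulr1.
have JJ : J * J = J *+ 4.
  apply/matrixP=> i j; rewrite mxE mulmxnE mxE.
  under eq_bigr do rewrite !mxE mulr1.
  by rewrite sumr_const card_ord.
(* With 12 = 4 * 3 the product is the identity, whose rank 4 exceeds the inner dimension 3. *)
have : \rank (A *m (B *m ((12%:R)^-1 *: (J - 3%:R)))) = 4.
  rewrite mulmxA gram -scalemxAl -scalemxAr scalerA -[_ *m _]/((J - 1) * (J - 3%:R)).
  have ->: (J - 1) * (J - 3%:R) = 3%:R%:M.
    rewrite mulrBl mul1r mulrBr JJ !mulr_natr.
    rewrite (_ : 3%:R%:M = 3%:R :> 'M[F]_4) ?rmorph_nat //.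
    by rewrite mulrS addrK opprB addrC subrK.
  rewrite scale_scalar_mx -[RHS](mxrank1 F 4); congr (\rank _); congr (_%:M).
  by field; rewrite -[12%N]/(4 * 3)%N natrM mulf_neq0 ?nz4.
by move=> rank4; have := mulmx_max_rank A (B *m ((12%:R)^-1 *: (J - 3%:R))); rewrite rank4.
Qed.

Lemma nilpotent2_clique (Y : {set vec}) : {in Y, forall N, nilpotent2 N} ->
  {in Y &, forall N M, polar N M = 0 \/ polar N M = 4%:R} ->
  (#|Y| <= 4)%N \/ exists2 N0, nilpotent2 N0 /\ N0 != 0
                   & {in Y, forall M, exists t, M = scale2 t N0}.
Proof.
move=> nY cY.
have [/exists_inP[N YN /exists_inP[M YM /eqP NM4]] | no4] :=
  boolP [exists N in Y, exists M in Y, polar N M == 4%:R].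
- left.
  (* If L were orthogonal to L', then L = t L', and [polar K L] = 4 t must be 0 or 4: so L = 0 or L
     = L'. *)
  have dich L L' K : L \in Y -> L' \in Y -> K \in Y -> polar K L' = 4%:R ->
    L != 0 -> L != L' -> polar L L' = 4%:R.
    move=> YL YL' YK KL4 nzL neL; have [o|//] := cY L L' YL YL'.
    have nzL' : L' != 0 by apply: contraNneq nz4 => L0; rewrite -KL4 L0 polar0r.
    rewrite polarC in o.
    have [t Dt] := nilpotent2_parallel (nY _ YL') (nY _ YL) nzL' o.
    have := cY K L YK YL; rewrite Dt polar_scaler KL4 => -[/eqP|/eqP].
      rewrite mulf_eq0 (negPf nz4) orbF => /eqP t0.
      by case/eqP: nzL; rewrite Dt t0 /scale2 !mul0r.
    rewrite -subr_eq0 -[X in _ - X]mul1r -mulrBl mulf_eq0 (negPf nz4) orbF subr_eq0.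
    by move/eqP=> t1; case/eqP: neL; rewrite Dt t1 /scale2 !mul1r -!surjective_pairing.
  (* At most one element of [Y] lies outside [Z]: two of them would form, with N and M, four vectors
     pairwise at 4. *)
  pose Z : {set vec} := [set (0 : vec); N; M].
  have Z3 : (#|Z| <= 3)%N.
    by rewrite /Z setUC cardsU1 cards2; lia.
  rewrite -(cardsID Z Y); have := subset_leq_card (subsetIr Y Z).
  have [D1 | /card_gt1P[L [L' [DL DL' neLL']]]] := leqP #|Y :\: Z| 1; first by lia.
  move: DL DL'; rewrite !inE !negb_or => /andP[/andP[/andP[nzL neLN] neLM] YL].
  move=> /andP[/andP[/andP[nzL' neLN'] neLM'] YL'] _.
  have LN := dich L N M YL YN YM; rewrite polarC in LN.
  have {}LN := LN NM4 nzL neLN.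
  have LM := dich L M N YL YM YN NM4 nzL neLM.
  have LN' := dich L' N M YL' YN YM; rewrite polarC in LN'.
  have {}LN' := LN' NM4 nzL' neLN'.
  have LM' := dich L' M N YL' YM YN NM4 nzL' neLM'.
  have LL' := dich L L' N YL YL' YN (etrans (polarC N L') LN') nzL neLL'.
  pose v (i : 'I_4) := nth (0 : vec) [:: N; M; L; L'] i.
  case: (@no_four_nilpotents v).
    by case=> [[|[|[|[|//]]]] Hi]; apply: nY.
  by case=> [[|[|[|[|//]]]] Hi] [[|[|[|[|//]]]] Hj] //= _;
     rewrite /v /= // polarC.
have [/subset_leq_card Y0 | /subsetPn[N0 YN0 nzN0]] := boolP (Y \subset [set (0 : vec)]).
  by left; apply: leq_trans Y0 _; rewrite cards1.
right; rewrite inE in nzN0; exists N0 => [|M YM]; first by split; first exact: nY.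
apply: nilpotent2_parallel (nY _ YN0) (nY _ YM) nzN0 _.
have [//|NM4] := cY N0 M YN0 YM.
by case/negP: no4; apply/exists_inP; exists N0 => //; apply/exists_inP; exists M; rewrite ?NM4.
Qed.

End IsotropicVectors.

(** * Unipotent matrices and transvections *)

Section Unipotents.

Variable F : finFieldType.

Notation vec := (F * F * F)%type.

Definition unip (N : vec) : {'GL_2[F]} :=
  sl2 (1 + N.1.1) N.1.2 N.2 (1 - N.1.1).

Definition transv (t : F) : {'GL_2[F]} := sl2 1 t 0 1.

Lemma unip_det (N : vec) : nilpotent2 N ->
  (1 + N.1.1) * (1 - N.1.1) - N.1.2 * N.2 = 1.
Proof.
move/eqP=> nN; transitivity (1 - (N.1.1 ^+ 2 + N.1.2 * N.2)); first by ring.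
by rewrite nN subr0.
Qed.

Lemma transv_det t : 1 * 1 - t * 0 = 1 :> F. Proof. by ring. Qed.

Lemma mem_unip N : nilpotent2 N -> unip N \in SL2 F.
Proof. by move=> nN; rewrite mem_sl2 ?unip_det. Qed.

Lemma mem_transv t : transv t \in SL2 F.
Proof. exact: mem_sl2 (transv_det t). Qed.

Lemma tr_transv t : \tr (GLval (transv t)) = 2%:R.
Proof. by rewrite tr_sl2 ?transv_det. Qed.

Lemma transvD s t : (transv s * transv t)%g = transv (s + t).
Proof. by rewrite sl2M ?transv_det //; congr sl2; ring. Qed.

Lemma transvX t n : (transv t ^+ n)%g = transv (t *+ n).
Proof.
elim: n => [|n IHn]; first by rewrite /transv mulr0n sl2_1 expg0.
by rewrite expgS IHn transvD mulrS.
Qed.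

Lemma transvV t : (transv t)^-1%g = transv (- t).
Proof. by rewrite sl2V ?transv_det // oppr0. Qed.

(** The source of the squares in the clique condition on field elements. *)
Lemma transvJ_diag (s t : F) : s != 0 ->
  (transv t ^ sl2 (s^-1)%R 0 0 s)%g = transv (s ^+ 2 * t).
Proof.
move=> nzs; have s_det : s^-1 * s - 0 * 0 = 1 by rewrite mulVf // mulr0 subr0.
rewrite conjgE; apply: (canLR (mulKg _)).
rewrite !sl2M ?transv_det //; congr sl2; by field.
Qed.

(** The inverse of 1 + M is 1 - M, and N and M are traceless. *)
Lemma tr_unipMV N M : nilpotent2 N -> nilpotent2 M ->
  \tr (GLval (unip N * (unip M)^-1)%g) = 2%:R - polar N M.
Proof.
move=> nN nM; rewrite sl2V ?unip_det // sl2M ?unip_det //; last first.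
  by rewrite -[RHS](unip_det nM); ring.
rewrite tr_sl2; first by rewrite /polar; ring.
transitivity (((1 + N.1.1) * (1 - N.1.1) - N.1.2 * N.2) *
              ((1 + M.1.1) * (1 - M.1.1) - M.1.2 * M.2)); first by ring.
by rewrite !unip_det ?mulr1.
Qed.

(** The matrix x - 1 has trace 0 and determinant 2 - tr x = 0. *)
Lemma trace2_unip x : x \in SL2 F -> \tr (GLval x) = 2%:R ->
  exists2 N, nilpotent2 N & x = unip N.
Proof.
case/SL2P=> a [b [c [d [det1 ->]]]]; rewrite tr_sl2 // => tr2.
have Dd : d = 1 - (a - 1) by rewrite -(addKr a d) tr2; ring.
exists (a - 1, b, c); last by rewrite /unip /= -Dd; congr sl2; ring.
apply/eqP => /=; transitivity (1 - (a * d - b * c)); last by rewrite det1 subrr.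
by rewrite Dd; ring.
Qed.

(** A single [P] serves the whole line through N, so a whole unipotent subgroup is moved to upper
    triangular form at once. *)
Lemma unip_transv N : nilpotent2 N -> N != 0 ->
  exists P e, [/\ P \in SL2 F, e != 0
                & forall t, unip (scale2 t N) = (transv (t * e)%R ^ P)%g].
Proof.
case: N => [[a b] c] nN nzN; move: (nN); rewrite /nilpotent2 /= => /eqP n0.
have [c0|nzc] := eqVneq c 0.
  move: n0; rewrite c0 mulr0 addr0 => /eqP; rewrite sqrf_eq0 => /eqP a0.
  exists 1%g, b; split=> [||t]; first exact: group1.
    by move: nzN; rewrite c0 a0 !xpair_eqE !eqxx /= andbT.
  by rewrite conjg1 /unip /transv a0 /=; congr sl2; ring.
(* The second row (c, -a) of [P] is that of N, and N = e P^-1 E12 P with e = -1/c. *)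
have P_det : 0 * - a - - c^-1 * c = 1 by rewrite mul0r sub0r mulNr opprK mulVf.
exists (sl2 0 (- c^-1) c (- a)), (- c^-1); split=> [||t]; first exact: mem_sl2.
  by rewrite oppr_eq0 invr_eq0.
rewrite conjgE; apply: (canRL (mulKg _)).
have nt := nilpotent2_scale t nN.
rewrite !sl2M ?transv_det ?unip_det //=; congr sl2; try by field.
have Db : b = - a ^+ 2 / c.
  by apply: (mulIf nzc); rewrite divfK //; apply: (addrI (a ^+ 2)); rewrite n0 subrr.
by rewrite Db; field.
Qed.

End Unipotents.

(** * The coset map modulo the center *)

Section CenterQuotient.

Variables (gT : finGroupType) (G : {group gT}).

Local Notation pi := (coset 'Z(G)).

Lemma mem_norm_center x : x \in G -> x \in ('N('Z(G)))%g.
Proof. exact/subsetP/(normal_norm (center_normal _)). Qed.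

Lemma coset_centerM x y : x \in G -> y \in G -> pi (x * y)%g = (pi x * pi y)%g.
Proof. by move=> Gx Gy; rewrite morphM ?mem_norm_center. Qed.

Lemma coset_centerV x : x \in G -> pi x^-1%g = (pi x)^-1%g.
Proof. by move=> Gx; rewrite morphV ?mem_norm_center. Qed.

Lemma coset_centerX x n : x \in G -> pi (x ^+ n)%g = (pi x ^+ n)%g.
Proof. by move=> Gx; rewrite morphX ?mem_norm_center. Qed.

Lemma coset_centerJ x y : x \in G -> y \in G -> pi (x ^ y)%g = (pi x ^ pi y)%g.
Proof. by move=> Gx Gy; rewrite morphJ ?mem_norm_center. Qed.

Lemma coset_center_eq x y : x \in G -> y \in G -> pi x = pi y ->
  (x * y^-1)%g \in 'Z(G)%g.
Proof.
move=> Gx Gy Exy; rewrite coset_idr ?groupM ?groupV ?mem_norm_center //.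
by rewrite coset_centerM ?groupV // coset_centerV // Exy mulgV.
Qed.

Lemma coset_center_eq1 x : x \in G -> pi x = 1%g -> x \in 'Z(G)%g.
Proof. by move=> Gx px1; rewrite coset_idr ?mem_norm_center. Qed.

End CenterQuotient.

(** * Conjugates in PSL(2, F) of the subgroup generated by a transvection *)

Section ProjectiveClasses.

Variable F : finFieldType.

Local Notation pi := (coset 'Z(SL2 F)).

Lemma mem_PSL2 x : x \in SL2 F -> pi x \in PSL2 F.
Proof. by move=> Sx; apply: mem_quotient. Qed.

Lemma PSL2P g : g \in PSL2 F -> exists2 x, x \in SL2 F & g = pi x.
Proof. by case/morphimP=> x _ Sx ->; exists x. Qed.

Lemma SL2M x y : x \in SL2 F -> y \in SL2 F -> (x * y)%g \in SL2 F.
Proof. by rewrite !inE GL_MxE det_mulmx => /eqP-> /eqP->; rewrite mulr1. Qed.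

Lemma SL2V x : x \in SL2 F -> x^-1%g \in SL2 F.
Proof.
case/SL2P=> a [b [c [d [det1 ->]]]]; rewrite sl2V // mem_sl2 //.
by rewrite -det1; ring.
Qed.

Lemma SL2J x y : x \in SL2 F -> y \in SL2 F -> (x ^ y)%g \in SL2 F.
Proof. by move=> Sx Sy; rewrite conjgE !SL2M ?SL2V. Qed.

Lemma SL2X x n : x \in SL2 F -> (x ^+ n)%g \in SL2 F.
Proof.
move=> Sx; elim: n => [|n IHn]; last by rewrite expgS SL2M.
by rewrite expg0 -sl2_1 mem_sl2 //; ring.
Qed.

Lemma piM x y : x \in SL2 F -> y \in SL2 F -> pi (x * y)%g = (pi x * pi y)%g.
Proof. exact: coset_centerM. Qed.

Lemma piV x : x \in SL2 F -> pi x^-1%g = (pi x)^-1%g.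
Proof. exact: coset_centerV. Qed.

Lemma piX x n : x \in SL2 F -> pi (x ^+ n)%g = (pi x ^+ n)%g.
Proof. exact: coset_centerX. Qed.

Lemma piJ x y : x \in SL2 F -> y \in SL2 F -> pi (x ^ y)%g = (pi x ^ pi y)%g.
Proof. exact: coset_centerJ. Qed.

Lemma pi_eqP x y : x \in SL2 F -> y \in SL2 F -> pi x = pi y ->
  exists2 e, e = 1 \/ e = -1 & x = (sl2 e 0 0 e * y)%g.
Proof.
move=> Sx Sy Exy; have /centerSL2P[e e1 Dxy] := coset_center_eq Sx Sy Exy.
by exists e => //; rewrite -Dxy mulgKV.
Qed.

Variable a : F.

Local Notation CS := (class_support <[pi (transv a)]> (PSL2 F)).

Lemma mem_CS_transv i g : g \in SL2 F -> pi (transv (a *+ i) ^ g)%g \in CS.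
Proof.
move=> Sg; rewrite piJ ?mem_transv // memJ_class_support ?mem_PSL2 //.
by rewrite -transvX piX ?mem_transv // mem_cycle.
Qed.

Lemma CS_transvP z : z \in SL2 F -> pi z \in CS ->
  exists i e g, [/\ e = 1 \/ e = -1, g \in SL2 F
                  & z = (sl2 e 0 0 e * transv (a *+ i) ^ g)%g].
Proof.
move=> Sz /imset2P[_ _ /cycleP[i ->] /PSL2P[g Sg ->]].
rewrite -piX ?mem_transv // transvX -piJ ?mem_transv //.
case/pi_eqP=> // [|e e1 ->]; first by rewrite SL2J ?mem_transv.
by exists i, e, g.
Qed.

(** A lift is, up to sign, a conjugate of a transvection. *)
Lemma CS_trace z : z \in SL2 F -> pi z \in CS ->
  \tr (GLval z) = 2%:R \/ \tr (GLval z) = - 2%:R.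
Proof.
move=> Sz /(CS_transvP Sz)[i [e [g [e1 Sg ->]]]].
have := trJ (transv (a *+ i)) g; rewrite tr_transv.
have: (transv (a *+ i) ^ g)%g \in SL2 F by apply: SL2J; first exact: mem_transv.
have e_det : e * e - 0 * 0 = 1 by case: e1 => ->; ring.
case/SL2P=> x [y [z' [w [det1 ->]]]]; rewrite tr_sl2 // sl2M // tr_sl2.
  by case: e1 => -> <-; [left | right]; ring.
by rewrite -[RHS]mulr1 -{1}e_det -det1; ring.
Qed.

Lemma CS_lift g : g \in CS -> exists2 N, nilpotent2 N & g = pi (unip N).
Proof.
case/imset2P=> [_ _ /cycleP[i ->] /PSL2P[x Sx ->]] ->.
rewrite -piX ?mem_transv // transvX -piJ ?mem_transv //.
have [||N nN ->] := @trace2_unip _ (transv (a *+ i) ^ x)%g; last by exists N.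
  by rewrite SL2J ?mem_transv.
by rewrite trJ tr_transv.
Qed.

Lemma CS_transv_square i s : pi (transv (s ^+ 2 * a *+ i)) \in CS.
Proof.
have [->|nzs] := eqVneq s 0.
  by rewrite expr0n mul0r mul0rn -(mulr0n a) -[transv _]conjg1 mem_CS_transv ?group1.
rewrite -mulrnAr -(transvJ_diag _ nzs) mem_CS_transv // mem_sl2 //.
by rewrite mulVf // mulr0 subr0.
Qed.

Hypothesis nz2 : 2%:R != 0 :> F.

(** The trace rules out the sign -1. For t nonzero, comparing entries in g u(t) = u(a i) g makes g
    upper triangular with diagonal (1/w, w), whence t = w ^ 2 a i. *)
Lemma CS_transv_inv t : pi (transv t) \in CS ->
  exists i s, t = s ^+ 2 * a *+ i.
Proof.
case/(CS_transvP (mem_transv t))=> i [e [g [e1 Sg Dt]]].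
have e_1 : e = 1.
  case: e1 => // e1; have := tr_transv t.
  have := trJ (transv (a *+ i)) g; rewrite tr_transv Dt.
  have: (transv (a *+ i) ^ g)%g \in SL2 F by apply: SL2J; first exact: mem_transv.
  have e_det : e * e - 0 * 0 = 1 by rewrite e1; ring.
  case/SL2P=> x [y [z' [w [det1 ->]]]]; rewrite tr_sl2 // sl2M // tr_sl2; last first.
    by rewrite -[RHS]mulr1 -{1}e_det -det1; ring.
  rewrite e1 => tr2 trN2; have: 2%:R * 2%:R = 0 :> F.
    by transitivity (2%:R + 2%:R : F); [ring | rewrite -{1}tr2 -trN2; ring].
  by move/eqP; rewrite mulf_eq0 (negPf nz2).
have: (g * transv t = transv (a *+ i) * g)%g.
  by rewrite Dt e_1 sl2_1 mul1g conjgE mulKVg.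
case/SL2P: Sg => x [y [z [w [det1 ->]]]]; rewrite !sl2M ?transv_det //.
case/sl2_inj=> [||_ Et _ Ew]; try by rewrite -[RHS]det1; ring.
have [->|nzt] := eqVneq t 0; first by exists 0%N, 0; rewrite mulr0n.
have z0 : z = 0.
  apply/eqP; rewrite -(mulIr_eq0 z (mulIf nzt)) -subr_eq0 subr0; apply/eqP.
  by apply: (addIr w); move: Ew; rewrite mulr1 !(mul0r, mul1r, add0r).
exists i, w; rewrite -mulrnAr.
have {}Et : x * t = a *+ i * w.
  by apply: (addIr y); move: Et; rewrite mulr1 mul1r => ->; rewrite addrC.
transitivity (w * (x * t)); last by rewrite Et; ring.
by rewrite mulrA [w * x]mulrC -[LHS]mul1r -{1}det1 z0 mulr0 subr0.
Qed.

End ProjectiveClasses.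

(** * Cyclic subgroups of order p, up to conjugacy *)

Section OrderPSubgroups.

Variables (F : finFieldType) (p : nat).
Hypotheses (charF : p \in [pchar F]) (odd_p : odd p).

Local Notation pi := (coset 'Z(SL2 F)).

Lemma GLvalX (x : {'GL_2[F]}) n : GLval (x ^+ n)%g = GLval x ^+ n.
Proof.
elim: n => [|n IHn]; first by rewrite expg0 GL_1E expr0.
by rewrite expgS GL_ME exprS -IHn.
Qed.

(* In characteristic p, (x - 1)^p = x^p - 1 = 0, so x - 1 is singular. *)
Lemma trace_order_p x : x \in SL2 F -> (x ^+ p)%g = 1%g -> \tr (GLval x) = 2%:R.
Proof.
move=> Sx xp1; have charM : p \in [pchar 'M[F]_2] by rewrite pchar_lalg.
have: (GLval x - 1) ^+ p = 0.
  rewrite -(pFrobenius_autE charM) pFrobenius_autB_comm; last exact: commr1.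
  by rewrite !pFrobenius_autE -GLvalX xp1 GL_1E expr1n subrr.
move/(congr1 (fun A : 'M[F]_2 => A \is a GRing.unit)).
rewrite unitr0 unitrX_pos ?odd_gt0 //.
case/SL2P: Sx => a [b [c [d [det1 ->]]]]; rewrite tr_sl2 // sl2_val //.
rewrite -[_ \is a _]/(_ \in unitmx) unitmxE unitfE => /negbFE/eqP.
rewrite (mx2_eta (_ - 1)) !mxE /= det_mx2 => det0.
apply/eqP; rewrite -subr_eq0 -oppr_eq0 -det0; apply/eqP.
transitivity (1 + 1 - a - d); first by ring.
by rewrite -{1}det1; ring.
Qed.

(** A lift x of a generator h satisfies x ^ p = 1 or -1. Passing to x ^ 2 removes the sign, and h ^
    2 still generates [H] as p is odd; so x ^ 2 is unipotent, hence conjugate to a transvection. *)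
Lemma order_p_transv (H : {group coset_of 'Z(SL2 F)}) :
  H \subset PSL2 F -> cyclic H -> #|H| = p ->
  exists a P, [/\ a != 0, P \in SL2 F & H = (<[pi (transv a)]> :^ pi P)%g :> {set _}].
Proof.
move=> sHG /cyclicP[h DH] oH.
have oh : (h ^+ p)%g = 1%g by rewrite -oH DH expg_order.
have /PSL2P[x Sx Dh] : h \in PSL2 F by rewrite (subsetP sHG) // DH cycle_id.
have Sy : (x ^+ 2)%g \in SL2 F by apply: SL2X.
have Dy : pi (x ^+ 2)%g = (h ^+ 2)%g by rewrite piX // Dh.
have Hh2 : <[h]>%g = <[h ^+ 2]>%g.
  apply/eqP; rewrite eqEsubset !cycle_subG mem_cycle andbT.
  (* Here (h ^ 2) ^ ((p + 1) / 2) = h ^ (p + 1) = h. *)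
  apply/cycleP; exists p.+1./2; rewrite -expgM mul2n even_halfK /= ?odd_p //.
  by rewrite expgS oh mulg1.
have yp : (x ^+ 2 ^+ p)%g = 1%g.
  have /centerSL2P[e e1 Dxp] : (x ^+ p)%g \in 'Z(SL2 F)%g.
    by apply: coset_center_eq1; [exact: SL2X | rewrite piX // -Dh].
  have e_det : e * e - 0 * 0 = 1 by case: e1 => ->; ring.
  rewrite -expgM mulnC expgM Dxp expgS expg1 sl2M // -sl2_1.
  by congr sl2; rewrite -?e_det; ring.
have [N nN yN] := trace2_unip Sy (trace_order_p Sy yp).
have nzN : N != 0.
  apply: contraTneq (prime_gt1 (pcharf_prime charF)) => N0.
  rewrite -oH DH Hh2 -Dy yN N0 /unip /= addr0 subr0 sl2_1.
  by rewrite coset_id ?group1 // cycle1 cards1.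
have [P [e [SP nze conjP]]] := unip_transv nN nzN.
exists e, P; split=> //; rewrite DH Hh2 -Dy yN.
have -> : N = scale2 1 N by rewrite /scale2 !mul1r -!surjective_pairing.
by rewrite conjP mul1r piJ ?mem_transv // cycleJ.
Qed.

End OrderPSubgroups.

(** * From intersecting sets to sets of field elements *)

Section Cliques.

Variables (F : finFieldType) (a : F).

Local Notation pi := (coset 'Z(SL2 F)).
Local Notation CS := (class_support <[pi (transv a)]> (PSL2 F)).

(** The condition for the transvections with parameters in [T] to have pairwise quotients in
    [CS]. *)
Definition line_clique (T : {set F}) : Prop :=
  {in T &, forall s t, exists i r, s - t = r ^+ 2 * a *+ i}.

Lemma transv_clique (T : {set F}) : line_clique T ->
  exists2 X : {set coset_of 'Z(SL2 F)}, X \subset PSL2 F /\ #|X| = #|T|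
    & {in X &, forall g h, (g * h^-1)%g \in CS}.
Proof.
move=> cT; exists [set pi (transv t) | t in T]; first split.
- by apply/subsetP=> _ /imsetP[t _ ->]; rewrite mem_PSL2 ?mem_transv.
- apply: card_in_imset => s t _ _ /pi_eqP[]; try exact: mem_transv.
  move=> e e1; have e_det : e * e - 0 * 0 = 1 by case: e1 => ->; ring.
  rewrite sl2M ?transv_det // => /sl2_inj[].
  + by ring.
  + by rewrite -[RHS]e_det; ring.
  by rewrite !mulr1 !mul0r !addr0 => <- -> _ _; rewrite mul1r.
move=> _ _ /imsetP[s Ts ->] /imsetP[t Tt ->].
have [i [r Dst]] := cT s t Ts Tt.
rewrite -piV ?mem_transv // -piM ?SL2V ?mem_transv //.
by rewrite transvV transvD Dst CS_transv_square.
Qed.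

Hypotheses (nz2 : 2%:R != 0 :> F) (nz3 : 3%:R != 0 :> F).

(** By [nilpotent2_clique], the lifts either number at most 4, which [m] absorbs, or lie on a line,
    where the bound on [line_clique] applies after conjugation. *)
Lemma clique_bound m (X : {set coset_of 'Z(SL2 F)}) : (4 <= m)%N ->
  (forall T : {set F}, line_clique T -> (#|T| <= m)%N) ->
  X \subset PSL2 F -> {in X &, forall g h, (g * h^-1)%g \in CS} -> (#|X| <= m)%N.
Proof.
move=> m_ge4 boundT sXG cX.
have [-> | [x0 Xx0]] := set_0Vmem X; first by rewrite cards0.
rewrite -(card_rcoset X x0^-1); set X1 := (X :* _)%g.
have {}cX : {in X1 &, forall g h, (g * h^-1)%g \in CS}.
  move=> _ _ /rcosetP[g Xg ->] /rcosetP[h Xh ->].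
  by rewrite invMg invgK mulgA mulgKV cX.
have X1_1 : 1%g \in X1 by rewrite mem_rcoset invgK mul1g.
(* Every element of [X1] has a lift in [Y], since 1 lies in [X1] and so the element itself lies in
   [CS]. *)
pose Y := [set N : F * F * F | nilpotent2 N && (pi (unip N) \in X1)].
have X1Y : (#|X1| <= #|Y|)%N.
  apply: leq_trans (leq_imset_card (fun N => pi (unip N)) (mem Y)).
  apply/subset_leq_card/subsetP=> g X1g.
  have := cX g _ X1g X1_1; rewrite invg1 mulg1 => /CS_lift[N nN Dg].
  by apply/imsetP; exists N; rewrite // inE nN -Dg.
apply: leq_trans X1Y _.
have nY : {in Y, forall N, nilpotent2 N} by move=> N; rewrite inE => /andP[].
have XY : {in Y, forall N, pi (unip N) \in X1} by move=> N; rewrite inE => /andP[].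
have cY : {in Y &, forall N M, polar N M = 0 \/ polar N M = 4%:R}.
  move=> N M YN YM; have SN := mem_unip (nY N YN); have SM := mem_unip (nY M YM).
  have := cX _ _ (XY N YN) (XY M YM).
  rewrite -piV // -piM ?SL2V // => /CS_trace[]; first by rewrite SL2M ?SL2V.
    rewrite tr_unipMV ?nY // => E.
    by left; rewrite -[polar N M](subKr 2%:R) E; ring.
  rewrite tr_unipMV ?nY // => E.
  by right; rewrite -[polar N M](subKr 2%:R) E; ring.
have [Y4 | [N0 [nN0 nzN0] Y_N0]] := nilpotent2_clique nz2 nz3 nY cY.
  exact: leq_trans Y4 m_ge4.
have [P [e [SP nze conjP]]] := unip_transv nN0 nzN0.
(* Dividing by [e] makes s the parameter of the conjugated transvection itself. *)
pose T := [set s | scale2 (s / e) N0 \in Y].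
apply: leq_trans (boundT T _).
  apply: leq_trans (leq_imset_card (fun s => scale2 (s / e) N0) (mem T)).
  apply/subset_leq_card/subsetP=> M YM; have [t DM] := Y_N0 M YM.
  apply/imsetP; exists (t * e); last by rewrite mulfK.
  by rewrite inE mulfK // -DM.
have XT s : s \in T -> pi (unip (scale2 (s / e) N0)) \in X1.
  by rewrite [s \in T]in_set; apply: XY.
move=> s t /XT Xs /XT Xt.
apply: (CS_transv_inv nz2).
have := cX _ _ Xs Xt; rewrite !conjP !divfK // !piJ ?mem_transv //.
rewrite -conjVg -conjMg -piV ?mem_transv // -piM ?SL2V ?mem_transv //.
rewrite transvV transvD memJ_norm //.
by apply: (subsetP (class_support_norm _ (PSL2_group F))); apply: mem_PSL2.
Qed.

End Cliques.

(** * Extremal sets of field elements for odd and even k *)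

Section LineCliques.

Variables (F : finFieldType) (p k : nat) (a : F).
Hypotheses (p_prime : prime p) (odd_p : odd p) (k_gt0 : (0 < k)%N).
Hypotheses (F_card : #|F| = (p ^ k)%N) (nza : a != 0).

Lemma line_clique_odd : odd k -> line_clique a [set: F].
Proof.
move=> odd_k s t _ _; set d := s - t.
have [/is_squareP[r Dr] | sq'd] := boolP (is_square (d / a)).
  by exists 1%N, r; rewrite mulr1n -Dr divfK.
have [i sq'i] := nat_nonsquare p_prime F_card odd_p odd_k.
(* From (d / a) i = r ^ 2 follows d = (r / i) ^ 2 a i. *)
have /is_squareP[r Dr] := nonsquareM sq'd sq'i.
have nzi := nonsquare_neq0 sq'i.
exists i, (r / i%:R); rewrite expr_div_n -Dr -mulr_natr.
by field; rewrite nza nzi.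
Qed.

Lemma line_clique_even : ~~ odd k ->
  exists2 T : {set F}, #|T| = (p ^ k./2)%N & line_clique a T.
Proof.
move=> even_k.
have [E [cardE subE sqE]] := square_subfield p_prime F_card odd_p k_gt0 erefl even_k.
exists [set a * x | x in E]; first by rewrite card_imset //; exact: mulfI.
move=> _ _ /imsetP[x Ex ->] /imsetP[y Ey ->].
have /is_squareP[r Dr] := sqE _ (subE x y Ex Ey).
by exists 1%N, r; rewrite -mulrBr Dr mulrC.
Qed.

(** Integers are squares in F, so dividing by [a] turns all differences into squares. *)
Lemma line_clique_even_bound (T : {set F}) : ~~ odd k ->
  line_clique a T -> (#|T| <= p ^ k./2)%N.
Proof.
move=> even_k cT; rewrite -leq_sqr -expnM muln2 even_halfK // -F_card.
have /card_imset <- : injective (fun t : F => t / a) by apply: mulIf; rewrite invr_eq0.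
apply: square_difference_clique; first exact: odd_card F_card odd_p.
move=> _ _ /imsetP[s Ts ->] /imsetP[t Tt ->].
have [i [r Dst]] := cT s t Ts Tt; rewrite -mulrBl Dst -mulr_natr mulrAC mulfK //.
apply: is_squareM; first by apply/is_squareP; exists r.
exact: is_square_nat p_prime F_card i odd_p k_gt0 even_k.
Qed.

End LineCliques.

(* R is any real closed field, e.g. the reals; it hosts the square root. *)
Theorem theorem1p3 (R : rcfType) (p k q : nat) (F : finFieldType)
    (p_prime : prime p) (p_ge5 : (5 <= p)%N) (k_ge1 : (1 <= k)%N)
    (q_def : q = (p ^ k)%N) (F_card : #|F| = q)
    (H : {group coset_of 'Z(SL2 F)})
    (H_sub : H \subset PSL2 F) (H_cyclic : cyclic H) (H_card : #|H| = p) :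
  ratr (intersection_density 'Rs%act (PSL2 F) (rcosets H (PSL2 F)))
    = (if odd k then q%:R / p%:R else Num.sqrt q%:R / p%:R) :> R.
Proof.
have F_card' : #|F| = (p ^ k)%N by rewrite F_card.
have charF : p \in [pchar F] := finField_pchar p_prime F_card' k_ge1.
have odd_p : odd p by case/even_prime: (p_prime) p_ge5 => [->|].
have nz2 : 2%:R != 0 :> F by rewrite -(dvdn_pcharf charF) gtnNdvd //; lia.
have nz3 : 3%:R != 0 :> F by rewrite -(dvdn_pcharf charF) gtnNdvd //; lia.
(* The conjugacy class of [H] enters only through [a], and the extremal sizes are the same for every
   nonzero [a]. *)
have [a [P [nza SP DH]]] := order_p_transv charF odd_p H_sub H_cyclic H_card.
have CS_H : class_support H (PSL2 F) =
    class_support <[coset 'Z(SL2 F) (transv a)]> (PSL2 F).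
  by rewrite DH (@class_supportGidl _ (PSL2_group F)) ?mem_PSL2.
have density m (T : {set F}) : (4 <= m)%N -> #|T| = m -> line_clique a T ->
    (forall U : {set F}, line_clique a U -> (#|U| <= m)%N) ->
    ratr (intersection_density 'Rs%act (PSL2 F) (rcosets H (PSL2 F)))
      = m%:R / p%:R :> R.
  move=> m_ge4 cardT cT boundT.
  rewrite (@intersection_density_rcosets _ (PSL2_group F) H H_sub m).
  - by rewrite H_card fmorph_div !rmorph_nat.
  - by rewrite CS_H -cardT; apply: transv_clique.
  by rewrite CS_H => X; apply: clique_bound.
(* As p >= 5, both q and, for even k, its square root reach the size 4 of the sporadic cliques. *)
have pX n : (0 < n)%N -> (4 <= p ^ n)%N.
  by move=> n_gt0; apply: leq_trans (leq_pexp2l (prime_gt0 p_prime) n_gt0); rewrite expn1 ltnW.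
case: ifPn => [odd_k | even_k].
  apply: (density q [set: F]); rewrite ?q_def ?pX ?cardsT //.
    exact: line_clique_odd p_prime odd_p F_card' nza odd_k.
  by move=> U _; rewrite -F_card' max_card.
have k2_gt0 : (0 < k./2)%N by case: (k) k_ge1 even_k => [|[]].
have [T cardT cT] := line_clique_even p_prime odd_p k_ge1 F_card' nza even_k.
rewrite (density _ T _ cardT cT) ?pX // => [|U cU].
  rewrite q_def -{2}(even_halfK even_k) -muln2 expnM (natrX _ _ 2) sqrtr_sqr.
  by rewrite ger0_norm ?ler0n.
exact: line_clique_even_bound p_prime odd_p k_ge1 F_card' nza U even_k cU.
Qed.
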